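(* Let $\Omega$ be a Cantor set, let $\mathcal{P}er\subset Homeo(\Omega)$ be the set of all pointwise periodic homeomorphisms of $\Omega$, and let $\mathcal{P}er_0\subset Homeo(\Omega)$ be the set of all periodic homeomorphisms with finite period, i.e. those $P\in Homeo(\Omega)$ for which there exists $N\in\mathbb N$ such that $P^Nx=x$ for all $x\in\Omega$. Let $\tau$ be the uniform topology and $p$ the weak topology on $Homeo(\Omega)$. Then: (1) $\overline{\mathcal{P}er_0}^{\tau}=Homeo(\Omega)$. (2) The set $\overline{\mathcal{P}er}^{p}$ is a proper subset of $Homeo(\Omega)$ containing the minimal homeomorphisms. (3) $\overline{\mathcal{P}er}^{p}=\overline{\mathcal{P}er_0}^{p}$.
   Context: A Cantor set is a non-empty compact metrizable space without isolated points having a base of clopen sets. $Homeo(\Omega)$ is the group of all homeomorphisms of $\Omega$. A homeomorphism $T$ is pointwise periodic if for every $x\in\Omega$ there is $n\in\mathbb N$ with $T^nx=x$ (where $n$ may depend on $x$). A homeomorphism $T$ is minimal if for every $x\in\Omega$ the orbit $\{T^nx : n\in\mathbb Z\}$ is dense in $\Omega$. For $S,T\in Homeo(\Omega)$ put $E(S,T)=\{x\in\Omega : Tx\neq Sx\}\cup\{x\in\Omega : T^{-1}x\neq S^{-1}x\}$. The uniform topology $\tau$ on $Homeo(\Omega)$ is the topology defined by the base of neighborhoods consisting of the sets $$U(T;\mu_1,\dots,\mu_n;\varepsilon)=\{S\in Homeo(\Omega) : \mu_i(E(S,T))<\varepsilon,\ i=1,\dots,n\},$$ where $T\in Homeo(\Omega)$,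 $\mu_1,\dots,\mu_n$ are Borel probability measures on $\Omega$, and $\varepsilon>0$. The weak topology $p$ on $Homeo(\Omega)$ is the topology defined by the base of neighborhoods consisting of the sets $$W(T;F_1,\dots,F_k)=\{S\in Homeo(\Omega) : SF_i=TF_i,\ i=1,\dots,k\},$$ where $T\in Homeo(\Omega)$ and $F_1,\dots,F_k$ are clopen subsets of $\Omega$. For $Y\subset Homeo(\Omega)$, $\overline{Y}^{\tau}$ and $\overline{Y}^{p}$ denote the closures of $Y$ in $Homeo(\Omega)$ with respect to $\tau$ and $p$, respectively. *)

(* Defs.v *)
From HB Require Import structures.
From mathcomp Require Import all_boot all_order all_algebra.
From mathcomp Require Import all_classical all_reals all_analysis.

Set Implicit Arguments.
Unset Strict Implicit.
Unset Printing Implicit Defensive.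

Import Order.TTheory GRing.Theory Num.Theory.

Local Open Scope classical_set_scope.
Local Open Scope ring_scope.

(* The inverse is determined by the forward map, and equality of proofs is
   available from boolp, so two elements are equal as soon as their forward maps
   agree. *)
Record homeo (X Y : topologicalType) := Homeo {
  hfun :> X -> Y ;
  hinv : Y -> X ;
  hfunK : cancel hfun hinv ;
  hinvK : cancel hinv hfun ;
  hfun_continuous : continuous hfun ;
  hinv_continuous : continuous hinv }.

HB.instance Definition _ (X Y : topologicalType) := gen_eqMixin (homeo X Y).
HB.instance Definition _ (X Y : topologicalType) := gen_choiceMixin (homeo X Y).

Lemma homeo_ext (X Y : topologicalType) (S T : homeo X Y) :
  (S : X -> Y) = T -> S = T.
Proof.
case: S => f g fK gK cf cg; case: T => f' g' fK' gK' cf' cg' /= ff'.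
subst f'; have gg' : g = g' by apply/funext => y; rewrite -{1}(gK' y) fK.
by subst g'; congr Homeo; exact: Prop_irrelevance.
Qed.

Definition metrizable (R : realType) (X : topologicalType) :=
  exists M : metricType R, inhabited (homeo X M).

Definition cantor_set (R : realType) (X : topologicalType) :=
  [/\ [set: X] !=set0,
      compact [set: X],
      metrizable R X,
      isolated [set: X] = set0 &
      exists2 B : set (set X), basis B & B `<=` clopen].

Section dynamics.
Context {X : topologicalType}.
Implicit Types (S T : homeo X X) (n : int).

(* T ^ n for n in Z; Negz m stands for - m.+1 *)
Definition hiter T n : X -> X :=
  match n with
  | Posz m => iter m T
  | Negz m => iter m.+1 (hinv T)
  end.

Definition pointwise_periodic T :=
  forall x, exists2 n : nat, (0 < n)%N & iter n T x = x.

Definition finite_period T :=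
  exists2 n : nat, (0 < n)%N & forall x, iter n T x = x.

Definition minimal_homeo T := forall x, dense [set hiter T n x | n in [set: int]].

Definition Ediff S T : set X :=
  [set x | T x <> S x] `|` [set x | hinv T x <> hinv S x].

End dynamics.

Definition borel (X : ptopologicalType) := g_sigma_algebraType (@open X).

Definition uniform_base (R : realType) (X : ptopologicalType) (T : homeo X X)
    (n : nat) (mu : 'I_n -> probability (borel X) R) (eps : R) :
    set (homeo X X) :=
  [set S | forall i, (mu i (Ediff S T) < eps%:E)%E].

Definition weak_base (X : topologicalType) (T : homeo X X)
    (k : nat) (F : 'I_k -> set X) : set (homeo X X) :=
  [set S | forall i, S @` F i = T @` F i].

(* The two topologies live on copies of the group of homeomorphisms.  In both,
   a set is open when it contains a basic neighbourhood of each of its points;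
   nbhs_uniform and nbhs_weak below show that the basic neighbourhoods are then
   indeed a base of neighbourhoods. *)
Definition homeo_uniform (R : realType) (X : ptopologicalType) := homeo X X.
Definition homeo_weak (X : topologicalType) := homeo X X.

HB.instance Definition _ (R : realType) (X : ptopologicalType) :=
  Choice.on (homeo_uniform R X).
HB.instance Definition _ (X : topologicalType) := Choice.on (homeo_weak X).

Definition cat_fam (A : Type) (m n : nat) (f : 'I_m -> A) (g : 'I_n -> A)
    (i : 'I_(m + n)) : A :=
  match fintype.split i with inl j => f j | inr j => g j end.

Lemma cat_fam_lshift (A : Type) m n (f : 'I_m -> A) (g : 'I_n -> A) i :
  cat_fam f g (lshift n i) = f i.
Proof. by rewrite /cat_fam -[lshift n i]/(unsplit (inl i)) unsplitK. Qed.

Lemma cat_fam_rshift (A : Type) m n (f : 'I_m -> A) (g : 'I_n -> A) i :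
  cat_fam f g (rshift m i) = g i.
Proof. by rewrite /cat_fam -[rshift m i]/(unsplit (inr i)) unsplitK. Qed.

Section homeo_uniform_topology.
Context {R : realType} {X : ptopologicalType}.

Definition uniform_open (O : set (homeo_uniform R X)) := forall T, O T ->
  exists (n : nat) (mu : 'I_n -> probability (borel X) R) (eps : R),
    0 < eps /\ uniform_base T mu eps `<=` O.

Let uniform_openT : uniform_open setT.
Proof.
move=> T _; have mu : 'I_0 -> probability (borel X) R by case.
by exists 0%N, mu, 1; split.
Qed.

Let uniform_openI : setI_closed uniform_open.
Proof.
move=> A B oA oB T [/oA[m [mu [e [e0 muA]]]] /oB[n [nu [d [d0 nuB]]]]].
exists (m + n)%N, (cat_fam mu nu), (Num.min e d); split.
  by rewrite lt_min e0 d0.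
move=> S US; split.
- apply: muA => i; have := US (lshift n i); rewrite cat_fam_lshift.
  by move=> /lt_le_trans; apply; rewrite lee_fin ge_min lexx.
- apply: nuB => i; have := US (rshift m i); rewrite cat_fam_rshift.
  by move=> /lt_le_trans; apply; rewrite lee_fin ge_min lexx orbT.
Qed.

Let uniform_open_bigU (I : Type) (f : I -> set (homeo_uniform R X)) :
  (forall i, uniform_open (f i)) -> uniform_open (\bigcup_i f i).
Proof.
move=> fo T [i _ /fo[n [mu [e [e0 sub]]]]]; exists n, mu, e; split => //.
by move=> S /sub fS; exists i.
Qed.

HB.instance Definition _ := isOpenTopological.Build (homeo_uniform R X)
  uniform_openT uniform_openI uniform_open_bigU.

End homeo_uniform_topology.

Section homeo_weak_topology.
Context {X : topologicalType}.

Definition weak_open (O : set (homeo_weak X)) := forall T, O T ->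
  exists (k : nat) (F : 'I_k -> set X),
    (forall i, clopen (F i)) /\ weak_base T F `<=` O.

Let weak_openT : weak_open setT.
Proof. by move=> T _; exists 0%N, (fun=> set0); split=> // -[]. Qed.

Let weak_openI : setI_closed weak_open.
Proof.
move=> A B oA oB T [/oA[m [F [cF FA]]] /oB[n [G [cG GB]]]].
exists (m + n)%N, (cat_fam F G); split.
  by move=> i; rewrite /cat_fam; case: fintype.split.
move=> S WS; split.
- by apply: FA => i; have := WS (lshift n i); rewrite cat_fam_lshift.
- by apply: GB => i; have := WS (rshift m i); rewrite cat_fam_rshift.
Qed.

Let weak_open_bigU (I : Type) (f : I -> set (homeo_weak X)) :
  (forall i, weak_open (f i)) -> weak_open (\bigcup_i f i).
Proof.
move=> fo T [i _ /fo[k [F [cF sub]]]]; exists k, F; split => //.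
by move=> S /sub fS; exists i.
Qed.

HB.instance Definition _ := isOpenTopological.Build (homeo_weak X)
  weak_openT weak_openI weak_open_bigU.

End homeo_weak_topology.

Lemma nbhs_weak (X : topologicalType) (T : homeo_weak X) (A : set (homeo_weak X)) :
  nbhs T A <-> exists (k : nat) (F : 'I_k -> set X),
    (forall i, clopen (F i)) /\ weak_base T F `<=` A.
Proof.
split=> [|[k [F [cF sub]]]].
  rewrite nbhsE => -[B [oB BT] BA]; have [k [F [cF sub]]] := oB _ BT.
  by exists k, F; split => //; exact: subset_trans BA.
rewrite nbhsE; exists (weak_base T F) => //; split; last by [].
move=> S WS; exists k, F; split => // S' WS' i.
by rewrite WS' WS.
Qed.

Lemma open_Ediff (X : topologicalType) (S T : homeo X X) :
  hausdorff_space X -> open (Ediff S T).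
Proof.
move=> hX.
suff neq (f g : X -> X) : continuous f -> continuous g ->
    open [set x | f x <> g x].
  by apply: openU; apply: neq; [exact: hfun_continuous..
    | exact: hinv_continuous | exact: hinv_continuous].
move=> cf cg; rewrite openE => x /= /eqP fgx.
move: hX; rewrite open_hausdorff => /(_ _ _ fgx)[[U V]] /= [fU gV] [oU oV UV].
have nU : nbhs x (f @^-1` U).
  by apply: cf; apply: open_nbhs_nbhs; split => //; exact/set_mem.
have nV : nbhs x (g @^-1` V).
  by apply: cg; apply: open_nbhs_nbhs; split => //; exact/set_mem.
apply: filterS (filterI nU nV) => y [/= Uy Vy] fgy.
by move/eqP: UV; apply/eqP/set0P; exists (f y); split => //; rewrite fgy.
Qed.

Lemma nbhs_uniform (R : realType) (X : ptopologicalType) (T : homeo_uniform R X)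
    (A : set (homeo_uniform R X)) : hausdorff_space X ->
  nbhs T A <-> exists (n : nat) (mu : 'I_n -> probability (borel X) R) (eps : R),
    0 < eps /\ uniform_base T mu eps `<=` A.
Proof.
move=> hX; have mE S S' : measurable (Ediff S S' : set (borel X)).
  by apply: sub_sigma_algebra; exact: open_Ediff.
split=> [|[n [mu [e [e0 sub]]]]].
  rewrite nbhsE => -[B [oB BT] BA]; have [n [mu [e [e0 sub]]]] := oB _ BT.
  by exists n, mu, e; split => //; exact: subset_trans BA.
rewrite nbhsE; exists (uniform_base T mu e) => //; split; last first.
  move=> i; suff -> : Ediff T T = set0 by rewrite measure0 lte_fin.
  by apply/seteqP; split=> x // [].
move=> S US.
pose d := \big[Num.min/1]_(i < n) (e - fine (mu i (Ediff S T))).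
have d0 : 0 < d.
  apply: lt_bigmin => // i _; rewrite subr_gt0 -lte_fin fineK //.
  exact: fin_num_measure.
exists n, mu, d; split => // S' US' i.
have sE : Ediff S' T `<=` Ediff S' S `|` Ediff S T.
  move=> x [] /= h.
  - have [TS|TS] := pselect (T x = S x); last by right; left.
    by left; left; rewrite /= -TS.
  - have [TS|TS] := pselect (hinv T x = hinv S x); last by right; right.
    by left; right; rewrite /= -TS.
apply: (@le_lt_trans _ _ (mu i (Ediff S' S) + mu i (Ediff S T))%E).
  apply: le_trans (measureU2 _ _ _) => //.
  by apply: le_measure => //; rewrite inE; [exact: mE | apply: measurableU; exact: mE].
have dle : d <= e - fine (mu i (Ediff S T)) by exact: bigmin_le_cond.
have : (mu i (Ediff S' S) < (e - fine (mu i (Ediff S T)))%:E)%E.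
  by apply: lt_le_trans (US' i) _; rewrite lee_fin.
have fS : mu i (Ediff S T) \is a fin_num by exact: fin_num_measure.
by rewrite EFinB fineK // lteBrDr.
Qed.

Definition closure_uniform (R : realType) (X : ptopologicalType)
    (Y : set (homeo X X)) : set (homeo X X) :=
  closure (Y : set (homeo_uniform R X)).

Definition closure_weak (X : topologicalType)
    (Y : set (homeo X X)) : set (homeo X X) :=
  closure (Y : set (homeo_weak X)).

(* Main.v *)
(* Let K be a clopen set met by every T-orbit within boundedly many steps.
   Cutting the orbits at K, that is sending each point of K back to the start of
   its orbit segment instead of forward, gives a homeomorphism Q of finite period
   which differs from T only on K.

   (2), (3): if two points of K on the same orbit always lie in the same atom of
   the partition generated by the clopen sets F_i, then Q F_i = T F_i.  For
   minimal T a single nonempty atom serves as K.  For pointwise periodic T one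
   builds K greedily from the atoms, because the saturation of a clopen set is
   then clopen.  Properness: a homeomorphism mapping some clopen F strictly into
   itself has no pointwise periodic S with S F = T F; such a homeomorphism is
   transported from the space of binary sequences.

   (1): for n large, K is built period by period.  Near the points of period
   d < n outside the orbits already marked, K meets each d-cycle once, and Q = T
   there up to small measure.  On the remaining compact set, whose points have
   period at least n, one adds a clopen L with L, T^-1 L, ..., T^-(n-1) L disjoint,
   after replacing it by the T^-j L of smallest measure. *)
Require Import Defs.
From HB Require Import structures.
From mathcomp Require Import all_boot all_order all_algebra.
From mathcomp Require Import all_classical all_reals all_analysis.
From mathcomp Require Import zify.

Set Implicit Arguments.
Unset Strict Implicit.
Unset Printing Implicit Defensive.

Import Order.TTheory GRing.Theory Num.Theory.

Local Open Scope classical_set_scope.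

(** * Iterates of a map and of its inverse *)

Section iterates.
Context {X : Type} (f g : X -> X).

Lemma iter_cancel n : cancel f g -> cancel (iter n f) (iter n g).
Proof. by move=> fK; elim: n => // n IH x; rewrite iterSr iterS fK IH. Qed.

Lemma iter_cancel_leq m n x : cancel f g -> (m <= n)%N ->
  iter m g (iter n f x) = iter (n - m) f x.
Proof. by move=> fK mn; rewrite -{1}(subnKC mn) iterD (iter_cancel _ fK). Qed.

Lemma iter_cancel_geq m n x : cancel f g -> (n <= m)%N ->
  iter m g (iter n f x) = iter (m - n) g x.
Proof. by move=> fK nm; rewrite -{1}(subnK nm) iterD (iter_cancel _ fK). Qed.

Lemma iter_period d k x : iter d f x = x -> iter (k * d) f x = x.
Proof. by move=> fx; elim: k => //= k IH; rewrite mulSn iterD IH. Qed.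

Lemma iter_periodC d i x : iter d f x = x -> iter d f (iter i f x) = iter i f x.
Proof. by move=> fx; rewrite -iterD addnC iterD fx. Qed.

End iterates.

(** * Clopen sets, continuity and compactness *)

Section clopen_sets.
Context {X : topologicalType}.
Implicit Types (A : set X) (f g : X -> X).

Lemma clopen_exists_lt n (F : nat -> set X) :
  (forall i, (i < n)%N -> clopen (F i)) ->
  clopen [set x | exists2 i, (i < n)%N & F i x].
Proof.
elim: n => [|n IH] cF.
  rewrite (_ : [set _ | _] = set0); first exact: clopen0.
  by apply/seteqP; split=> x //= [].
rewrite (_ : [set _ | _] = [set x | exists2 i, (i < n)%N & F i x] `|` F n).
  apply: clopenU; last exact: cF.
  by apply: IH => i /ltnW; exact: cF.
apply/seteqP; split=> x /=.
  by move=> [i]; rewrite ltnS leq_eqVlt => /predU1P[->|ilt] Fi; [right|left; exists i].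
by move=> [[i ilt Fi]|Fn]; [exists i => //; exact: ltnW | exists n].
Qed.

Lemma continuous_if A f g : clopen A -> continuous f -> continuous g ->
  continuous (fun x => if `[< A x >] then f x else g x).
Proof.
move=> [oA cA] cf cg x.
have [Ax|nAx] := pselect (A x).
  rewrite /continuous_at asboolT //; apply: cvg_trans (cf x); apply: near_eq_cvg.
  by apply: filterS (open_nbhs_nbhs (conj oA Ax)) => y Ay; rewrite asboolT.
rewrite /continuous_at asboolF //; apply: cvg_trans (cg x); apply: near_eq_cvg.
apply: filterS (open_nbhs_nbhs (conj (closed_openC cA) nAx)) => y nAy.
by rewrite asboolF.
Qed.

Lemma continuous_iter f n : continuous f -> continuous (iter n f).
Proof.
move=> cf; elim: n => [|n IH] x; first exact: cvg_id.
exact: (continuous_comp (IH x) (cf _)).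
Qed.

(** Compactness in near-covering form along the filter at infinity. It turns hitting times that
    depend on the point into one uniform bound. *)
Lemma compact_exhaustion (A : nat -> set X) : compact [set: X] ->
  (forall n, open (A n)) -> (forall m n, (m <= n)%N -> A m `<=` A n) ->
  (forall x, exists n, A n x) -> exists n, forall x, A n x.
Proof.
move=> /compact_near_coveringP cX oA mA coverA.
have [|N _ AN] := cX nat \oo%classic A _.
  move=> x _; have [n Anx] := coverA x.
  exists (A n, [set m | (n <= m)%N]) => /=.
    by split; [exact: open_nbhs_nbhs | exists n].
  by move=> [y m] [/= Any nm]; exact: mA nm _ Any.
by exists N => x; apply: AN => /=.
Qed.

End clopen_sets.

(** * Cutting orbits at a clopen set *)

Section cutting.
Context {X : topologicalType}.
Implicit Types (T : homeo X X) (A K : set X).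

Definition homeo_inv T : homeo X X :=
  Homeo (hinvK T) (hfunK T) (@hinv_continuous _ _ T) (@hfun_continuous _ _ T).

(** Both directions of time are allowed, so the notion is invariant under replacing [T] by its
    inverse. *)
Definition within_steps T n A : set X :=
  [set x | exists2 i, (i < n)%N & A (iter i T x) \/ A (iter i (hinv T) x)].

Lemma clopen_within_steps T n A : clopen A -> clopen (within_steps T n A).
Proof.
move=> cA.
apply: (@clopen_exists_lt _ n (fun i => iter i T @^-1` A `|` iter i (hinv T) @^-1` A)).
move=> i _; apply: clopenU; apply: preimage_clopen => //; apply: continuous_iter.
  exact: hfun_continuous.
exact: hinv_continuous.
Qed.

(** First entry into [A], truncated after [n] steps: it is total, and for clopen [A] a finite
    nesting of continuous case distinctions. *)
Fixpoint walk (f : X -> X) A n x :=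
  if n is m.+1 then if `[< A x >] then x else walk f A m (f x) else x.

Lemma continuous_walk f A n : clopen A -> continuous f -> continuous (walk f A n).
Proof.
move=> cA cf; elim: n => [|n IH] /=; first by move=> x; exact: cvg_id.
apply: continuous_if => // x; first exact: cvg_id.
exact: (continuous_comp (cf x) (IH _)).
Qed.

Lemma walk_first f A n i x : (i <= n)%N -> A (iter i f x) ->
  (forall j, (j < i)%N -> ~ A (iter j f x)) -> walk f A n x = iter i f x.
Proof.
elim: n i x => [|n IH] [|i] x //= ilen Ai nA; first by rewrite asboolT.
rewrite asboolF; last exact: (nA 0%N).
rewrite -iterS iterSr; apply: IH => //; first by rewrite -iterSr.
by move=> j jlt; rewrite -iterSr; exact: nA.
Qed.

Lemma walk_spec f A n x : (exists2 i, (i < n)%N & A (iter i f x)) ->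
  exists i, [/\ (i < n)%N, A (iter i f x), walk f A n x = iter i f x &
    forall j, (j < i)%N -> ~ A (iter j f x)].
Proof.
move=> [k kn Ak].
have exA : exists i, `[< A (iter i f x) >] by exists k; exact/asboolP.
have [i /asboolP Ai imin] := ex_minnP exA.
have nA j : (j < i)%N -> ~ A (iter j f x).
  by move=> ji Aj; have := imin j (introT (asboolP _) Aj); rewrite leqNgt ji.
have ilt : (i < n)%N by apply: leq_ltn_trans kn; apply: imin; exact/asboolP.
by exists i; split => //; apply: walk_first => //; exact: ltnW.
Qed.

Lemma within_steps_inv T n A : within_steps (homeo_inv T) n A = within_steps T n A.
Proof.
by apply/seteqP; split=> x [i ilt [H|H]]; exists i => //=; [right|left|right|left].
Qed.

(** Seen from [iter n T x], fewer than [n] steps backward still end on the forward orbit of [x]. *)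
Lemma forward_hit T n A : (forall x, within_steps T n A x) ->
  forall x, exists2 i, (i < n + n)%N & A (iter i T x).
Proof.
move=> hit x; have [i ilt Ai] := hit (iter n T x).
have ltn_n := ltnW ilt.
case: Ai => Ai.
  by exists (i + n)%N; rewrite ?ltn_add2r // iterD.
exists (n - i)%N; last by rewrite -(iter_cancel_leq _ (hfunK T)).
lia.
Qed.

Lemma cut_homeo T K n : clopen K -> (forall x, within_steps T n K x) ->
  exists Q : homeo X X, [/\ finite_period Q,
    forall x, ~ K x -> Q x = T x &
    forall x, K x -> exists r z, [/\ K z, iter r.+1 T z = x, Q x = T z &
      forall i, (0 < i <= r)%N -> ~ K (iter i T z)]].
Proof.
move=> cK hit; pose N := (n + n)%N.
have fhit : forall x, exists2 i, (i < N)%N & K (iter i T x) by exact: forward_hit.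
have bhit : forall x, exists2 i, (i < N)%N & K (iter i (hinv T) x).
  by apply: (@forward_hit (homeo_inv T)) => x; rewrite within_steps_inv.
pose S := hinv T.
(* From a point of [K], [q] walks back to the start of its segment, the first point whose
   [T]-preimage lies in [K]. From a segment start, [q'] walks forward to the next point of [K]. *)
pose q x := if `[< K x >] then walk S (S @^-1` K) N x else T x.
pose q' y := if `[< (S @^-1` K) y >] then walk T K N y else S y.
have TK : cancel T S := hfunK T.
have SK : cancel S T := hinvK T.
have bspec x : exists i, [/\ (i < N)%N, K (S (iter i S x)),
    walk S (S @^-1` K) N x = iter i S x &
    forall j, (j < i)%N -> ~ K (S (iter j S x))].
  apply: (@walk_spec S (S @^-1` K)); have [i ilt Ki] := bhit (S x).
  by exists i => //=; rewrite -iterS iterSr.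
have cS : continuous S := @hinv_continuous _ _ T.
have cT : continuous T := @hfun_continuous _ _ T.
have cSK : clopen (S @^-1` K) by exact: preimage_clopen.
have qK : cancel q q'.
  move=> x; rewrite /q; case: asboolP => Kx; last by rewrite /q' asboolF /= TK.
  have [i [ilt Ki -> Kmin]] := bspec x.
  rewrite /q' asboolT // (@walk_first _ _ _ i) ?(iter_cancel _ SK) //.
    exact: ltnW.
  move=> j ji; rewrite (iter_cancel_leq _ SK) ?(ltnW ji) //.
  have -> : (i - j = (i - j).-1.+1)%N by lia.
  by apply: Kmin; lia.
have q'K : cancel q' q.
  move=> y; rewrite /q'; case: asboolP => /= Ky; last first.
    by rewrite /q asboolF // SK.
  have [i [ilt Ki -> Kmin]] := walk_spec (fhit y).
  rewrite /q asboolT // (@walk_first _ _ _ i) /= ?(iter_cancel _ TK) //.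
    exact: ltnW.
  move=> j ji; rewrite -iterS (iter_cancel_leq _ TK) //.
  by apply: Kmin; lia.
have cq : continuous q by apply: continuous_if => //; exact: continuous_walk.
have cq' : continuous q' by apply: continuous_if => //; exact: continuous_walk.
exists (Homeo qK q'K cq cq') => /=.
have q_off x : ~ K x -> q x = T x by move=> nKx; rewrite /q asboolF.
have iter_q j y : (forall i, (i < j)%N -> ~ K (iter i T y)) -> iter j q y = iter j T y.
  elim: j => // j IH nK; rewrite iterS IH; last by move=> i /ltnW; exact: nK.
  by rewrite q_off //; exact: nK.
have q_on x : K x -> exists r z, [/\ (r < N)%N, K z, iter r.+1 T z = x, q x = T z &
      forall i, (0 < i <= r)%N -> ~ K (iter i T z)].
  move=> Kx; have [r [rlt Kz qx Kmin]] := bspec x.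
  exists r, (iter r.+1 S x); split => //.
  - by rewrite (iter_cancel _ SK).
  - by rewrite iterS SK /q asboolT.
  - move=> i /andP[i0 ir]; rewrite (iter_cancel_leq _ SK); last by lia.
    have -> : (r.+1 - i = (r - i).+1)%N by lia.
    by apply: Kmin; lia.
split=> //.
(* Each segment is a [q]-cycle of some length [r.+1] at most [N], so the factorial is a common
   period. *)
- exists N`! => [|x]; first exact: fact_gt0.
  have [j [jlt Kj _ Kmin]] := walk_spec (fhit x).
  have [r [z [rlt Kz zx qx Kr]]] := q_on _ Kj.
  have per : iter r.+1 q (iter j T x) = iter j T x.
    rewrite iterSr qx iter_q => [|i ir]; last by rewrite -iterSr; apply: Kr; lia.
    by rewrite -iterSr zx.
  have per' : iter r.+1 q x = x.
    apply: (can_inj (iter_cancel j qK)).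
    by rewrite -iterD addnC iterD (iter_q j).
  have /dvdnP[k ->] : (r.+1 %| N`!)%N by apply: dvdn_fact.
  exact: iter_period.
- by move=> x /q_on[r [z [_ ? ? ? ?]]]; exists r, z.
Qed.

End cutting.

(** * Weak approximation: general criterion and minimal homeomorphisms *)

Section weak_approximation.
Context {X : topologicalType}.
Implicit Types (T : homeo X X) (A K U : set X).

Lemma clopen_forall (I : finType) (G : I -> set X) :
  (forall i, clopen (G i)) -> clopen [set x | forall i, G i x].
Proof.
move=> cG; split.
  rewrite openE => x Gx; apply: filter_forall => i; apply: open_nbhs_nbhs.
  by split; [have [] := cG i | exact: Gx].
rewrite (_ : [set _ | _] = \bigcap_i G i); first by apply: closed_bigI => i _; have [] := cG i.
by apply/seteqP; split=> x Gx i; [move=> _; exact: Gx | exact: Gx].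
Qed.

Lemma clopen_iff (P : Prop) A : clopen A -> clopen [set x | P <-> A x].
Proof.
move=> cA; have [p|np] := pselect P.
  rewrite (_ : [set _ | _] = A) //.
  by apply/seteqP; split=> x /=; tauto.
rewrite (_ : [set _ | _] = ~` A); first exact: clopenC.
by apply/seteqP; split=> x /=; tauto.
Qed.

Lemma closure_weakP (Y : set (homeo X X)) T :
  closure_weak Y T <-> forall k (F : 'I_k -> set X), (forall i, clopen (F i)) ->
    exists2 Q, Y Q & weak_base T F Q.
Proof.
split=> [clT k F cF|clT B].
  have /clT[Q [YQ WQ]] : nbhs (T : homeo_weak X) (weak_base T F).
    by apply/nbhs_weak; exists k, F; split.
  by exists Q.
move=> /nbhs_weak[k [F [cF FB]]]; have [Q YQ WQ] := clT k F cF.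
by exists Q; split => //; exact: FB.
Qed.

Definition same_atom k (F : 'I_k -> set X) x y := forall i, F i x <-> F i y.

(** Always [Q x = T z] with [z] in the atom of [x]: [z] is [x] off [K], and the previous visit to
    [K] otherwise. Reading this at the [Q]-preimage of [T x] gives the reverse inclusion. *)
Lemma cut_weak_base T K n k (F : 'I_k -> set X) : clopen K ->
  (forall x, within_steps T n K x) ->
  (forall x m, K x -> K (iter m T x) -> same_atom F x (iter m T x)) ->
  exists2 Q : homeo X X, finite_period Q & weak_base T F Q.
Proof.
move=> cK hit KF; have [Q [perQ Qoff Qon]] := cut_homeo cK hit.
exists Q => // i.
have QT x : exists2 z, Q x = T z & same_atom F x z.
  have [Kx|nKx] := pselect (K x); last by exists x; [exact: Qoff|].
  have [r [z [Kz zx Qx _]]] := Qon _ Kx; exists z => // j.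
  by rewrite -zx; symmetry; apply: KF => //; rewrite zx.
apply/seteqP; split=> _ [x Fx <-].
  by have [z -> xz] := QT x; exists z => //; apply/xz.
exists (hinv Q (T x)); last by rewrite hinvK.
have [z] := QT (hinv Q (T x)); rewrite hinvK => /(can_inj (hfunK T)) <- xz.
exact/xz.
Qed.

Lemma minimal_closure_weak T (x0 : X) : compact [set: X] -> minimal_homeo T ->
  closure_weak [set Q | finite_period Q] T.
Proof.
move=> cX minT; apply/closure_weakP => k F cF.
pose K := [set x | same_atom F x0 x].
have cK : clopen K.
  apply: (@clopen_forall _ (fun i => [set x | F i x0 <-> F i x])) => i.
  exact: clopen_iff.
have [n hit] : exists n, forall x, within_steps T n K x.
  apply: compact_exhaustion => //.
  - by move=> n; have [] := clopen_within_steps T n cK.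
  - by move=> m n mn x [i im Ki]; exists i => //; exact: leq_trans im mn.
  - move=> x; have [|y [Ky [[m|m] _ my]]] := minT x K _ (proj1 cK).
    + by exists x0.
    (* The bound in [within_steps] is strict, and [Negz m] already stands for [m.+1] backward
       steps. *)
    + by exists m.+1, m => //; left; rewrite [iter _ _ _]my.
    + by exists m.+2, m.+1 => //; right; rewrite [iter _ _ _]my.
by apply: cut_weak_base cK hit _ => x m Kx Kmx i; rewrite -(Kx i); exact: Kmx.
Qed.

(** * Weak approximation of pointwise periodic homeomorphisms *)

Section pointwise_periodic.
Context (T : homeo X X) (cX : compact [set: X]) (ppT : pointwise_periodic T).

(** Forward iterates suffice because every orbit is a finite cycle. *)
Definition saturation A : set X := [set x | exists n, A (iter n T x)].

Lemma saturation_iter A n x : saturation A (iter n T x) <-> saturation A x.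
Proof.
split=> [[m Am]|[m Am]]; first by exists (m + n)%N; rewrite iterD.
(* After [n] steps, [n * d - n] more complete [n] turns of the cycle and lead back to [x]. *)
have [d d0 dx] := ppT x; exists (n * d - n + m)%N.
have nd : (n <= n * d)%N by rewrite leq_pmulr.
by rewrite -iterD addnAC subnK // addnC iterD iter_period.
Qed.

(* A point of the complement W of U leaves W only through points e of W with
   T e in U.  The points e whose last n backward iterates lie in W form a
   decreasing sequence of clopen sets with empty intersection, since T e is also
   a backward iterate of e; so staying in W for a fixed number of steps implies
   staying there forever. *)
Lemma clopen_saturation U : clopen U -> clopen (saturation U).
Proof.
move=> cU; pose S := hinv T.
pose A n := [set e | ~ U (T e)] `|` [set e | exists2 i, (i < n)%N & U (iter i S e)].
have cS : continuous S := @hinv_continuous _ _ T.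
have cT : continuous T := @hfun_continuous _ _ T.
have [n An] : exists n, forall e, A n e.
  apply: compact_exhaustion => //.
  - move=> n; apply: openU.
      by have [] := preimage_clopen (clopenC U cU) cT.
    suff [] : clopen [set e | exists2 i, (i < n)%N & U (iter i S e)] by [].
    apply: (@clopen_exists_lt _ n (fun i => iter i S @^-1` U)) => i _.
    by apply: preimage_clopen => //; exact: continuous_iter.
  - move=> m n mn e [nU|[i im Ui]]; first by left.
    by right; exists i => //; exact: leq_trans im mn.
  - move=> e; have [UTe|nUTe] := pselect (U (T e)); last by exists 0%N; left.
    have [[|d] // _ dTe] := ppT (T e).
    exists d.+1; right; exists d => //.
    have Te : iter d T (T e) = e by apply: (can_inj (hfunK T)).
    by rewrite /= -[X in iter d S X]Te (iter_cancel _ (hfunK T)).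
suff -> : saturation U = [set x | exists2 i, (i <= n)%N & U (iter i T x)].
  apply: (@clopen_exists_lt _ n.+1 (fun i => iter i T @^-1` U)) => i _.
  by apply: preimage_clopen => //; exact: continuous_iter.
apply/seteqP; split=> x; last by move=> [i _ Ui]; exists i.
move=> [m]; elim/ltn_ind: m => m IH Um.
have [mn|nm] := leqP m n; first by exists m.
case: m nm IH Um => // m nm IH Um.
have [//|[i ilt]] := An (iter m T x).
rewrite (iter_cancel_leq _ (hfunK T)); last by lia.
by apply: IH; lia.
Qed.

(** Each [U] contributes only its points on orbits that [K] misses so far. Hence all points of the
    final [K] on one orbit come from the same member of [s]. *)
Lemma pointwise_periodic_markers (s : seq (set X)) (E : X -> X -> Prop) :
  (forall U, U \in s -> clopen U) ->
  (forall U, U \in s -> forall x y, U x -> U y -> E x y) ->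
  exists K, [/\ clopen K, forall x, (exists2 U, U \in s & U x) -> saturation K x &
    forall x m, K x -> K (iter m T x) -> E x (iter m T x)].
Proof.
elim: s => [|U s IH] cs Es.
  by exists set0; split => // [|x [] //]; exact: clopen0.
have [V Vs|V Vs|K [cK sK KE]] := IH.
- by apply: cs; rewrite inE Vs orbT.
- by apply: Es; rewrite inE Vs orbT.
exists (K `|` (U `\` saturation K)); split.
- apply: clopenU => //; apply: clopenI; first by apply: cs; rewrite mem_head.
  by apply: clopenC => //; exact: clopen_saturation.
- have sub x : saturation K x -> saturation (K `|` (U `\` saturation K)) x.
    by move=> [m Km]; exists m; left.
  move=> x [V]; rewrite inE => /predU1P[->|Vs] Vx; last first.
    by apply/sub/sK; exists V.
  have [Kx|nKx] := pselect (saturation K x); first exact: sub.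
  by exists 0%N; right.
- have K_sat x : K x -> saturation K x by exists 0%N.
  move=> x m [Kx|[Ux nKx]] [Kmx|[Umx nKmx]].
  + exact: KE.
  + by case: nKmx; apply/saturation_iter; exact: K_sat.
  + by case: nKx; apply/(saturation_iter _ m); exact: K_sat.
  + by apply: (Es U); rewrite ?mem_head.
Qed.

(** The atoms, possibly empty, are indexed by Boolean vectors. They cover the space, so the markers
    built from them meet every orbit. *)
Lemma pointwise_periodic_closure_weak : closure_weak [set Q | finite_period Q] T.
Proof.
apply/closure_weakP => k F cF.
pose atom (a : {ffun 'I_k -> bool}) := [set x | forall i, a i <-> F i x].
have [U|U|K [cK sK KE]] :=
    @pointwise_periodic_markers [seq atom a | a <- enum [set: {ffun 'I_k -> bool}]%SET]
      (same_atom F).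
- move=> /mapP[a _ ->].
  apply: (@clopen_forall _ (fun i => [set x | a i <-> F i x])) => i.
  exact: clopen_iff.
- by move=> /mapP[a _ ->] x y ax ay i; rewrite -(ax i); exact: ay.
have satT x : saturation K x.
  apply: sK; pose a := [ffun i => `[< F i x >]].
  exists (atom a); first by apply/mapP; exists a; rewrite ?mem_enum ?inE.
  by move=> i; rewrite ffunE; split => /asboolP.
have [n hit] : exists n, forall x, within_steps T n K x.
  apply: compact_exhaustion => //.
  - by move=> n; have [] := clopen_within_steps T n cK.
  - by move=> m n mn x [i im Ki]; exists i => //; exact: leq_trans im mn.
  - by move=> x; have [m Km] := satT x; exists m.+1, m => //; left.
exact: cut_weak_base cK hit KE.
Qed.

End pointwise_periodic.
End weak_approximation.

(** * Clopen markers without short returns *)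

Section markers.
Context {X : ptopologicalType} (cX : compact [set: X]) (zX : zero_dimensional X).
Hypothesis clopen_sub : forall (O : set X) x, open O -> O x ->
  exists U, [/\ clopen U, U x & U `<=` O].
Implicit Types (T : homeo X X) (K O U Z : set X).

(** Equivalently, the preimages of [U] under the first [d] iterates, from exponent 0 on, are
    pairwise disjoint. *)
Definition return_free T d U :=
  forall x i, (0 < i < d)%N -> U x -> ~ U (iter i T x).

Lemma return_free_sub T d U V : U `<=` V -> return_free T d V -> return_free T d U.
Proof. by move=> UV fV x i id /UV Ux /UV; exact: fV id Ux. Qed.

(** For each new exponent, a clopen [V] separating [z] from that iterate is trimmed by its own
    preimage, so no remaining point returns to [V] at that time. *)
Lemma return_free_nbhs T d z : (forall i, (0 < i < d)%N -> iter i T z <> z) ->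
  exists U, [/\ clopen U, U z & return_free T d U].
Proof.
elim: d => [|[|d] IH] zd.
- by exists setT; split=> //; [exact: clopenT | move=> x i; lia].
- by exists setT; split=> //; [exact: clopenT | move=> x i; lia].
have [|U [cU Uz fU]] := IH; first by move=> i /andP[i0 id]; apply: zd; rewrite i0 ltnW.
have /eqP/zX[V [cV Vz nV]] : z <> iter d.+1 T z by apply/nesym/zd; rewrite /= ltnSn.
exists (U `&` (V `\` iter d.+1 T @^-1` V)); split => //.
  apply: clopenI => //; apply: clopenI => //; apply: clopenC => //.
  by apply: preimage_clopen => //; apply: continuous_iter; exact: hfun_continuous.
move=> x i /andP[i0]; rewrite ltnS leq_eqVlt => /predU1P[->|id].
  by move=> [_ [_ nVx]] [_ []].
by move=> [Ux _] [Uix _]; apply: fU Ux Uix; rewrite i0.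
Qed.

(** Greedy union: deleting [within_steps T d K] from [U] before adding it excludes short passages
    between old and new points in both directions, and the deleted points are already near [K] along
    their orbits. *)
Lemma return_free_union T d (s : seq (set X)) O : (0 < d)%N ->
  (forall U, U \in s -> [/\ clopen U, U `<=` O & return_free T d U]) ->
  exists K, [/\ clopen K, K `<=` O, return_free T d K &
    forall U, U \in s -> U `<=` within_steps T d K].
Proof.
move=> d0; elim: s => [|U s IH] gs.
  by exists set0; split=> [|x []|x i _ []|//]; exact: clopen0.
have [V Vs|K [cK KO fK sK]] := IH; first by apply: gs; rewrite inE Vs orbT.
have [cU UO fU] := gs U (mem_head _ _).
have cKw := clopen_within_steps T d cK.
exists (K `|` (U `\` within_steps T d K)); split.
- by apply: clopenU => //; apply: clopenI => //; exact: clopenC.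
- by move=> x [/KO|[/UO]].
- move=> x i id [Kx|[Ux nKx]] [Kix|[Uix nKix]].
  + exact: fK Kx Kix.
  + case: nKix; exists i; first by case/andP: id.
    by right; rewrite (iter_cancel _ (hfunK T)).
  + by case: nKx; exists i; [case/andP: id | left].
  + exact: fU Ux Uix.
- have sub : within_steps T d K `<=` within_steps T d (K `|` (U `\` within_steps T d K)).
    by move=> x [i id [Ki|Ki]]; exists i => //; [left; left | right; left].
  move=> V; rewrite inE => /predU1P[->|Vs] x Vx; last by apply/sub/(sK V).
  have [Kx|nKx] := pselect (within_steps T d K x); first exact: sub.
  by exists 0%N => //; left; right.
Qed.

(** A topological form of Rokhlin's lemma: finitely many return-free clopen neighbourhoods cover the
    compact set [Z] and are then merged. *)
Lemma marker_exists T d Z O : (0 < d)%N -> closed Z -> open O -> Z `<=` O ->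
  (forall z i, Z z -> (0 < i < d)%N -> iter i T z <> z) ->
  exists K, [/\ clopen K, K `<=` O, return_free T d K & Z `<=` within_steps T d K].
Proof.
move=> d0 clZ oO ZO aperZ.
have := subclosed_compact clZ cX (@subsetT _ Z).
rewrite compact_cover => /(_ (set X)
  [set U | [/\ clopen U, U `<=` O & return_free T d U]] id).
case=> [U [[]] //|z Zz|D gD ZD].
  have [U [cU Uz UO]] := clopen_sub oO (ZO _ Zz).
  have [V [cV Vz fV]] := return_free_nbhs (aperZ z ^~ Zz).
  exists (U `&` V) => //; split; [exact: clopenI | by move=> x [/UO] |].
  exact: return_free_sub fV.
have [|K [cK KO fK sK]] := @return_free_union T d (finmap.enum_fset D) O d0.
  by move=> U /gD; rewrite inE.
by exists K; split=> // z /ZD[U UD]; exact: sK.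
Qed.

End markers.

(** * Outer regularity of fixed-point sets *)

Section outer_regularity.
Local Open Scope ring_scope.
Context {R : realType} {X : ptopologicalType}.
Variable nu : {measure set (borel X) -> \bar R}.
Hypothesis nu_fin : (nu setT < +oo)%E.

Lemma open_borel (O : set X) : open O -> measurable (O : set (borel X)).
Proof. exact: sub_sigma_algebra. Qed.

Lemma closed_borel (Z : set X) : closed Z -> measurable (Z : set (borel X)).
Proof.
move=> cZ; rewrite -[Z]setCK; apply: measurableC.
by apply: open_borel; exact: closed_openC.
Qed.

Lemma closed_fixpoints (f : X -> X) : hausdorff_space X -> continuous f ->
  closed [set x | f x = x].
Proof.
move=> hX cf x clx; apply: hX => A B nA nB.
have nfA : nbhs x (f @^-1` A) by exact: (cf x).
have [y [/= fy [Ay By]]] := clx _ (filterI nfA nB).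
by exists (f y); split => //; rewrite fy.
Qed.

(** In the metric model, the points moved by less than [1/(n+1)] decrease to the fixed points, and
    the finite measure [nu] is continuous from above. *)
Lemma fixpoints_outer_regular (f : X -> X) (delta : R) : metrizable R X ->
  hausdorff_space X -> continuous f -> 0 < delta ->
  exists O : set X, [/\ open O, [set x | f x = x] `<=` O &
    (nu (O `\` [set x | f x = x]) < delta%:E)%E].
Proof.
move=> [M [h]] hX cf d0; set Fix := [set x | f x = x].
have ch := @hfun_continuous _ _ h.
have chf : continuous (h \o f) by move=> y; exact: (continuous_comp (cf y) (ch _)).
pose O n : set X := interior [set x | ball (h x) n.+1%:R^-1 (h (f x))].
have oO n : open (O n) by exact: open_interior.
have FixO n : Fix `<=` O n.
  move=> x fx; rewrite /O /interior /=.
  have n0 : 0 < n.+1%:R^-1 / 2 :> R by rewrite divr_gt0 // invr_gt0.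
  near=> y; rewrite (splitr n.+1%:R^-1); apply: (@ball_triangle _ _ (h x)).
    by apply: ball_sym; near: y; apply: ch; exact: nbhsx_ballx.
  by near: y; apply: chf; rewrite /= (fx : f x = x); exact: nbhsx_ballx.
have capO : \bigcap_n (O n `\` Fix) = set0.
  apply/seteqP; split => // x /= Ox; have [_ nfx] := Ox 0%N I; apply: nfx.
  apply/esym/(can_inj (hfunK h))/mdist_positivity/eqP.
  rewrite eq_le mdist_ge0 andbT; apply/ler_addgt0Pr => e e0; rewrite add0r.
  have [n _ ne] := near_infty_natSinv_lt (PosNum e0).
  have [/interior_subset /= Bx _] := Ox n I.
  by move: Bx; rewrite ballEmdist /= => /ltW/le_trans; apply; apply/ltW/ne => /=.
have mO n : measurable (O n `\` Fix : set (borel X)).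
  apply: measurableD; first exact: open_borel.
  by apply: closed_borel; exact: closed_fixpoints.
have := @nonincreasing_cvg_mu _ _ _ nu (fun n => O n `\` Fix) _ mO.
rewrite capO measure0 => /(_ _ measurable0 _) cvgO.
have F0 : (nu (O 0%N `\` Fix) < +oo)%E.
  by apply: le_lt_trans nu_fin; apply: le_measure; rewrite ?inE.
have niF : nonincreasing_seq (fun n => O n `\` Fix).
  move=> m n mn; apply/subsetPset; apply: setSD; apply: interiorS => x.
  apply: le_ball; rewrite lef_pV2 ?posrE ?ltr0n // ler_nat ltnS //.
have nlt : nbhs (0%E : \bar R) [set y | (y < delta%:E)%E].
  apply: open_nbhs_nbhs; split; first exact: open_ereal_lt_ereal.
  by rewrite /= lte_fin.
have [n _ ltn] := cvgO F0 niF _ nlt.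
by exists (O n); split => //; exact: (ltn n (leqnn n)).
Unshelve. all: by end_near. Qed.

(** * Approximation in one finite measure *)

Section uniform_approximation.
Hypothesis mX : metrizable R X.
Hypothesis hX : hausdorff_space X.
Hypothesis cX : compact [set: X].
Hypothesis zX : zero_dimensional X.
Hypothesis clopen_sub : forall (O : set X) x, open O -> O x ->
  exists U, [/\ clopen U, U x & U `<=` O].
Variable T : homeo X X.

(** For [x] in [K]: [x] is the only point of [K] on its cycle, whose length is below [n]. *)
Definition full_cycle (K : set X) n x := exists e,
  [/\ (0 < e < n)%N, iter e T x = x &
    forall i, (0 < i < e)%N -> ~ K (iter i T x)].

(** The previous visit [z] shares the period [e]. If the gap [r.+1] were below [e], [x] would reach
    [z] in [K] too early; if above, [z] would return to itself before reaching [x]. So [z = x], and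
    the cut leaves [T] unchanged at [x]. *)
Lemma full_cycle_return (K : set X) n x r z : full_cycle K n x -> K x -> K z ->
  iter r.+1 T z = x -> (forall i, (0 < i <= r)%N -> ~ K (iter i T z)) -> T z = T x.
Proof.
move=> [e [/andP[e0 en] ex nK]] Kx Kz zx nKz; congr (T _).
have ez : iter e T z = z.
  apply: (can_inj (iter_cancel r.+1 (hfunK T))).
  by rewrite -iterD addnC iterD zx ex.
have [re|er|re] := ltngtP r.+1 e; last by rewrite -zx re.
  case: (nK (e - r.+1)%N); first by lia.
  by rewrite -zx -iterD subnK ?ez // ltnW.
by case: (nKz e); rewrite ?ez // e0.
Qed.

(** Induction on the largest period treated. [B] collects the points near a fixed-point set but
    outside it, where [K] need not meet a whole cycle once; each period costs at most [delta]. *)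
Lemma periodic_markers n d (delta : R) : (d < n)%N -> 0 < delta ->
  exists (K B : set X), [/\ clopen K, measurable (B : set (borel X)),
    (nu B <= (d%:R * delta)%:E)%E,
    forall x e, (0 < e <= d)%N -> iter e T x = x -> within_steps T n K x &
    forall x, K x -> ~ B x -> full_cycle K n x].
Proof.
move=> dn d0; elim: d dn => [|d IH] dn.
  exists set0, set0; split=> //; [exact: clopen0 | by rewrite measure0 mul0r|].
  by move=> x e; lia.
have [K [B [cK mB nuB hitK KB]]] := IH (ltnW dn).
have cKw := clopen_within_steps T n cK.
have cTd : continuous (iter d.+1 T).
  by apply: continuous_iter; exact: hfun_continuous.
have [W [oW FW nuW]] := fixpoints_outer_regular mX hX cTd d0.
set Fix := [set x | iter d.+1 T x = x] in FW nuW.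
have clFix : closed Fix by exact: closed_fixpoints.
(* Points of [Fix] not yet within reach of [K] have no period below [d.+1], since [hitK] covers
   those periods. *)
have [L [cL LW fL ZL]] : exists L, [/\ clopen L, L `<=` W `\` within_steps T n K,
    return_free T d.+1 L & Fix `\` within_steps T n K `<=` within_steps T d.+1 L].
  apply: marker_exists => //.
  - by apply: closedI => //; apply: open_closedC; have [] := cKw.
  - by apply: openI => //; apply: closed_openC; have [] := cKw.
  - by move=> x [/FW].
  - move=> z i [Fz nKz] /andP[i0 id] zi; apply: nKz; apply: hitK zi.
    by rewrite i0.
have mWF : measurable (W `\` Fix : set (borel X)).
  by apply: measurableD; [exact: open_borel | exact: closed_borel].
exists (K `|` L), (B `|` (W `\` Fix)); split.
- exact: clopenU.
- exact: measurableU.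
- apply: (le_trans (measureU2 nu mB mWF)).
  by rewrite -natr1 mulrDl mul1r EFinD; apply: leeD => //; exact: ltW.
- have subK x : within_steps T n K x -> within_steps T n (K `|` L) x.
    by move=> [i id [Ki|Ki]]; exists i => //; [left; left | right; left].
  move=> x e /andP[e0]; rewrite leq_eqVlt => /predU1P[->|ed] ex; last first.
    by apply: subK; apply: hitK ex; rewrite e0.
  have [Kx|nKx] := pselect (within_steps T n K x); first exact: subK.
  have [i id [Li|Li]] := ZL x (conj ex nKx); exists i; rewrite ?(ltn_trans id) //.
    by left; right.
  by right; right.
- move=> x [Kx|Lx] nBx.
    have [|e [/andP[e0 en] ex nK]] := KB x Kx; first by move=> Bx; apply: nBx; left.
    (* An old cycle stays free of [L]: its points lie within [n] steps of [K], a region that [L]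
       avoids. *)
    exists e; split=> // [|i /[dup] ie /nK nKi [//|/LW[_]]]; first by rewrite e0.
    case; exists i; first by lia.
    by right; rewrite (iter_cancel _ (hfunK T)).
  have [Wx nKx] := LW x Lx.
  have Fx : Fix x by apply: contrapT => nFx; apply: nBx; right.
  exists d.+1; split=> // i id [Ki|]; last exact: fL Lx.
  by apply: nKx; exists i; [lia | left].
Qed.

Lemma finite_period_close (eps : R) : 0 < eps ->
  exists (Q : homeo X X) (D : set X), [/\ finite_period Q,
    measurable (D : set (borel X)), (nu D < eps%:E)%E &
    forall x, Q x <> T x -> D x].
Proof.
move=> eps0.
pose c := fine (nu setT).
have cE : nu setT = c%:E by rewrite fineK // ge0_fin_numE.
(* Chosen so that [n] disjoint sets cannot all have measure at least [eps / 2]. *)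
pose n := (Num.truncn (c / (eps / 2))).+1.
have en0 : 0 < eps / 2 by rewrite divr_gt0.
have nc : c < n%:R * (eps / 2).
  by rewrite -ltr_pdivrMr // /n truncnS_gt.
have n0 : 0 < n%:R :> R by rewrite ltr0n.
pose delta := eps / 2 / n%:R.
have delta0 : 0 < delta by rewrite divr_gt0.
have [K [B [cK mB nuB hitK KB]]] := @periodic_markers n n.-1 delta (ltnSn _) delta0.
have cKw := clopen_within_steps T n cK.
have cKwC := clopenC setT cKw.
have [L [cL LO fL ZL]] : exists L, [/\ clopen L, L `<=` ~` within_steps T n K,
    return_free T n L & ~` within_steps T n K `<=` within_steps T n L].
  apply: marker_exists => //; [by have [] := cKwC | by have [] := cKwC |].
  by move=> z i nKz /andP[i0 id] zi; apply: nKz; apply: hitK zi; rewrite i0.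
pose Lj j := iter j T @^-1` L.
have cLj j : clopen (Lj j).
  by apply: preimage_clopen => //; apply: continuous_iter; exact: hfun_continuous.
have mLj j : measurable (Lj j : set (borel X)) by apply: open_borel; have [] := cLj j.
have [j jn nuLj] : exists2 j, (j < n)%N & (nu (Lj j) < (eps / 2)%:E)%E.
  apply: contrapT => nj; suff : ((n%:R * (eps / 2))%:E <= nu setT)%E.
    by rewrite cE lee_fin leNgt nc.
  have trivL : trivIset `I_n Lj.
    apply/trivIsetP => i k /= ilt klt; wlog ik : i k ilt klt / (i < k)%N.
      move=> H; rewrite neq_ltn => /orP[ik|ki]; first by apply: H => //; rewrite ltn_eqF.
      by rewrite setIC; apply: H => //; rewrite ltn_eqF.
    move=> _; apply/seteqP; split=> // x [Li Lk].
    apply: (fL (iter i T x) (k - i)%N _ Li).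
      by rewrite subn_gt0 ik (leq_ltn_trans (leq_subr _ _) klt).
    by rewrite -iterD subnK // ltnW.
  have mUL : measurable (\big[setU/set0]_(k < n) Lj k : set (borel X)).
    exact: bigsetU_measurable.
  apply: (@le_trans _ _ (nu (\big[setU/set0]_(k < n) Lj k))); last first.
    by apply: le_measure; rewrite ?inE.
  have -> := @measure_semi_additive_ord_I _ (borel X) R nu Lj n (fun k _ => mLj k) trivL mUL.
  have -> : (n%:R * (eps / 2))%:E = (\sum_(i < n) (eps / 2)%:E)%E.
    by rewrite sumEFin sumr_const card_ord mulr_natl.
  apply: lee_sum => i _; rewrite leNgt; apply/negP => Lji.
  by apply: nj; exists (i : nat).
(* Passing from [L] to its [j]-th preimage shifts hitting times by [j < n], hence the doubled
   bound. *)
have hit x : within_steps T (n + n) (K `|` Lj j) x.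
  have [[i id Ki]|nKx] := pselect (within_steps T n K x).
    by exists i; [exact: ltn_addr | case: Ki; [left; left | right; left]].
  have [i id [Li|Li]] := ZL x nKx; last first.
    exists (i + j)%N; first by rewrite -addSn leq_add // ltnW.
    right; right; rewrite /Lj /= addnC iterD.
    by rewrite (iter_cancel _ (hinvK T)).
  have [ij|ji] := leqP i j.
    exists (j - i)%N; first exact/(leq_ltn_trans (leq_subr _ _))/ltn_addr.
    by right; right; rewrite /Lj /= (iter_cancel_geq _ (hinvK T)) ?leq_subr ?subKn.
  exists (i - j)%N; first exact/(leq_ltn_trans (leq_subr _ _))/ltn_addr.
  by left; right; rewrite /Lj /= -iterD subnKC // ltnW.
have [Q [perQ Qoff Qon]] := cut_homeo (clopenU cK (cLj j)) hit.
exists Q, (B `|` Lj j); split=> //; first exact: measurableU.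
  apply: (le_lt_trans (measureU2 nu mB (mLj j))).
  rewrite [eps]splitr EFinD; apply: lee_ltD => //.
    by rewrite ge0_fin_numE //; apply: le_lt_trans nuB _; exact: ltry.
  apply: le_trans nuB _; rewrite lee_fin /delta mulrCA ler_piMr ?(ltW en0) //.
  by rewrite ler_pdivrMr // mul1r ler_nat.
move=> x nQT; have [[Kx|]|nKx] := pselect ((K `|` Lj j) x).
- left; apply: contrapT => nBx; apply: nQT.
  have [|r [z [Kz zx -> nKz]]] := Qon x; first by left.
  apply: (full_cycle_return (K := K `|` Lj j) (n := n) _ _ Kz zx nKz); last by left.
  have [e [/andP[e0 en] ex nK]] := KB x Kx nBx.
  (* If the cycle of [x] met [Lj j], it would meet [L] and return there after [e < n] steps. *)
  exists e; split=> // [|i id [|Li]]; [by rewrite e0 | exact: nK |].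
  apply: (fL _ e _ Li); first by rewrite e0.
  have eix := iter_periodC i ex.
  by rewrite (iter_periodC j eix); exact: Li.
- by right.
- by case: nQT; exact: Qoff.
Qed.
End uniform_approximation.

End outer_regularity.

(** * A compressing homeomorphism of binary sequences *)

Section cantor_space_maps.

Lemma near_prefix (x : cantor_space) m :
  \forall y \near x, forall k, (k < m)%N -> y k = x k.
Proof.
elim: m => [|m IH]; first by near=> y.
have nm : \forall y \near x, y m = x m.
  apply: (@proj_continuous nat (fun=> bool) m x [set x m]).
  by apply: open_nbhs_nbhs; split => //; exact: discrete_open.
near=> y; move=> k; rewrite ltnS leq_eqVlt => /predU1P[->|]; first by near: y.
by move: k; near: y.
Unshelve. all: by end_near. Qed.

Lemma continuous_prefix (g : cantor_space -> cantor_space) :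
  (forall n, exists m, forall x y : cantor_space,
    (forall k, (k < m)%N -> y k = x k) -> g y n = g x n) -> continuous g.
Proof.
move=> gm x; apply/cvg_sup => n.
move: x; apply/(@continuousP _ (initial_topology (@^~ n))) => A [B oB <-].
rewrite openE => x Bx; have [m gxy] := gm n.
by apply: filterS (near_prefix x m) => y xy; rewrite /= (gxy x y xy).
Qed.

(* A generator of Thompson's group: 00w -> 0w, 01w -> 10w, 1w -> 11w.  It maps
   the sequences starting with 1 onto those starting with 11. *)
Definition thompson (x : cantor_space) : cantor_space := fun n =>
  if x 0%N then (if n is m.+1 then x m else true)
  else if x 1%N then (match n with 0 => true | 1 => false | _ => x n end)
  else x n.+1.

Definition thompson_inv (y : cantor_space) : cantor_space := fun n =>
  if y 0%N then
    (if y 1%N then y n.+1 else match n with 0 => false | 1 => true | _ => y n end)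
  else (if n is m.+1 then y m else false).

Lemma thompsonK : cancel thompson thompson_inv.
Proof.
move=> x; apply/funext => n; rewrite /thompson_inv /thompson.
by case x0 : (x 0%N); case x1 : (x 1%N); case: n => [|[|n]]; rewrite ?x0 ?x1.
Qed.

Lemma thompson_invK : cancel thompson_inv thompson.
Proof.
move=> y; apply/funext => n; rewrite /thompson_inv /thompson.
by case y0 : (y 0%N); case y1 : (y 1%N); case: n => [|[|n]]; rewrite ?y0 ?y1.
Qed.

Lemma continuous_thompson : continuous thompson.
Proof.
(* Output coordinate [n] reads input coordinates up to [n.+1] only. *)
apply: continuous_prefix => n; exists n.+2 => x y xy; rewrite /thompson !xy //.
by case: n xy => [|[|n]] xy; rewrite ?xy //; lia.
Qed.

Lemma continuous_thompson_inv : continuous thompson_inv.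
Proof.
apply: continuous_prefix => n; exists n.+2 => x y xy; rewrite /thompson_inv !xy //.
by case: n xy => [|[|n]] xy; rewrite ?xy //; lia.
Qed.

End cantor_space_maps.

(** * Cantor sets and properness of the weak closure *)

Section cantor_sets.
Context {R : realType} {X : ptopologicalType} (cantorX : cantor_set R X).

Lemma cantor_set_hausdorff : hausdorff_space X.
Proof.
have [_ _ [M [h]] _ _] := cantorX.
move=> x y xy; apply: (can_inj (hfunK h)); apply: (@metric_hausdorff R M).
move=> A B /hfun_continuous nA /hfun_continuous nB.
by have [z [Az Bz]] := xy _ _ nA nB; exists (h z).
Qed.

Lemma cantor_set_clopen_sub (A : set X) x : open A -> A x ->
  exists U, [/\ clopen U, U x & U `<=` A].
Proof.
move=> oA Ax; have [_ _ _ _ [B [_ bB] cB]] := cantorX.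
have [U [BU Ux] UA] := bB x A (open_nbhs_nbhs (conj oA Ax)).
by exists U; split=> //; exact: cB.
Qed.

Lemma cantor_set_zero_dimensional : zero_dimensional X.
Proof.
move=> x y xy; have := cantor_set_hausdorff; rewrite open_hausdorff.
move=> /(_ _ _ xy)[[A B] /= [/set_mem Ax /set_mem By] [oA _ AB]].
have [U [cU Ux UA]] := cantor_set_clopen_sub oA Ax.
exists U; split=> // /UA Ay; move/eqP: AB; apply/eqP/set0P.
by exists y.
Qed.

(** Brouwer's characterisation, applied to the metric model [M] pointed at [h point]. The resulting
    bijection is closed, so its inverse is continuous. *)
Lemma cantor_set_homeo : inhabited (homeo cantor_space X).
Proof.
have [_ cX [M [h]] isoX _] := cantorX.
pose P : pseudoPMetricType R :=
  HB.pack_for (pseudoPMetricType R) M (isPointed.Build M (h point)).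
have ch : continuous (h : X -> P) := @hfun_continuous _ _ h.
have ch' : continuous (hinv h : P -> X) := @hinv_continuous _ _ h.
have hK := hfunK h; have h'K := hinvK h.
have hP : hausdorff_space P by exact: (@metric_hausdorff R M).
have likeP : cantor_like P.
  split=> //.
  - apply/perfectTP => m om.
    have /perfectTP/(_ (hinv h m)) : perfect_set [set: X].
      by apply/perfectP; split => //; exact: closedT.
    apply; rewrite (_ : [set _] = h @^-1` [set m]).
      by apply: open_comp => // x _; exact: ch.
    apply/seteqP; split=> x /=; first by move=> ->; rewrite h'K.
    by move=> <-; rewrite hK.
  - rewrite (_ : [set: P] = h @` [set: X]).
      apply: (@continuous_compact X P) => //; exact: continuous_subspaceT.
    by apply/seteqP; split=> y // _; exists (hinv h y).
  - move=> x y /eqP xy.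
    have /eqP/cantor_set_zero_dimensional[U [cU Ux nUy]] : hinv h x <> hinv h y.
      by move=> /(can_inj h'K).
    exists (hinv h @^-1` U); split => //.
    by have := @preimage_clopen P X _ _ cU ch'.
have [f [cf clf]] := homeomorphism_cantor_like likeP.
have fK : cancel f f^-1%FUN by move=> x; rewrite funK ?inE.
have f'K : cancel f^-1%FUN f by move=> x; rewrite invK ?inE.
have cf' : continuous (f^-1%FUN : P -> cantor_space).
  apply/continuous_closedP => A /clf; congr closed; apply/seteqP; split=> y /=.
    by move=> [x Ax <-]; rewrite fK.
  by move=> Ay; exists (f^-1%FUN y).
have cg : continuous (hinv h \o f).
  by move=> x; exact: (continuous_comp (cf x) (ch' _)).
have cg' : continuous (f^-1%FUN \o h).
  by move=> x; exact: (continuous_comp (ch x) (cf' _)).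
by split; exact: (Homeo (can_comp h'K fK) (can_comp f'K hK) cg cg').
Qed.

(** If [P F = T F], the [P]-orbit of [x] stays in [F]; periodicity then puts [x] itself in [P F],
    which is [T F]. *)
Lemma compressing_not_closure_weak (T : homeo X X) (F : set X) x : clopen F ->
  T @` F `<=` F -> F x -> ~ (T @` F) x ->
  ~ closure_weak [set P | pointwise_periodic P] T.
Proof.
move=> cF TF Fx nTFx clT.
have [P /= ppP WP] := (closure_weakP _ _).1 clT 1%N (fun=> F) (fun=> cF).
have PF : P @` F = T @` F := WP ord0.
have [[|n] // _ Pnx] := ppP x; apply: nTFx; rewrite -PF -{}Pnx.
suff : F (iter n P x) by move=> Fn; exists (iter n P x).
elim: n => //= n IH; apply: TF; rewrite -PF.
by exists (iter n P x).
Qed.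

Lemma compressing_homeo_exists : exists (T : homeo X X) (F : set X) x,
  [/\ clopen F, T @` F `<=` F, F x & ~ (T @` F) x].
Proof.
have [h] := cantor_set_homeo.
pose t := h \o (thompson \o hinv h); pose t' := h \o (thompson_inv \o hinv h).
have tK : cancel t t' by move=> x; rewrite /t /t' /= !hfunK thompsonK hinvK.
have t'K : cancel t' t by move=> x; rewrite /t /t' /= !hfunK thompson_invK hinvK.
have conj_continuous (g : cantor_space -> cantor_space) : continuous g ->
    continuous (h \o (g \o hinv h)).
  move=> cg x; have ch' := @hinv_continuous _ _ h x.
  exact: (continuous_comp (continuous_comp ch' (cg _)) (@hfun_continuous _ _ h _)).
pose F0 := [set x : cantor_space | x 0%N].
have cF0 : clopen F0.
  apply: (@preimage_clopen cantor_space bool (fun x => x 0%N) [set true]).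
    by split; [exact: discrete_open | exact: discrete_closed].
  exact: (@proj_continuous nat (fun=> bool) 0%N).
exists (Homeo tK t'K (conj_continuous _ continuous_thompson)
  (conj_continuous _ continuous_thompson_inv)).
(* The sequence 1000... lies in [F0], but the image of [F0] consists of sequences starting with
   11. *)
exists (hinv h @^-1` F0), (h (fun n => n == 0%N)); split.
- by apply: preimage_clopen => //; exact: hinv_continuous.
- by move=> _ [x /= Fx <-]; rewrite /F0 /= hfunK /thompson /= Fx.
- by rewrite /F0 /= hfunK.
- move=> [x /= Fx /(can_inj (hfunK h))/(congr1 (fun y : cantor_space => y 1%N))].
  by rewrite /thompson /= Fx.
Qed.

End cantor_sets.

(** * Uniform density of finite-period homeomorphisms *)

Section uniform_closure.
Local Open Scope ring_scope.
Context {R : realType} {X : ptopologicalType}.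

Definition hinv_borel (T : homeo X X) : borel X -> borel X := hinv T.

Let measurable_hinv T : measurable_fun setT (hinv_borel T).
Proof.
apply: (@measurability _ _ (borel X) (borel X) setT _ (@open X)) => //.
move=> _ [A oA <-]; rewrite setTI.
apply: open_borel; apply: open_comp => // x _; exact: hinv_continuous.
Qed.

HB.instance Definition _ T := isMeasurableFun.Build _ _ _ _ _ (measurable_hinv T).

(** The sum of the [mu i] works, which reduces finitely many measures to one. *)
Lemma finite_domination n (mu : 'I_n -> probability (borel X) R) :
  exists nu : {measure set (borel X) -> \bar R}, (nu setT < +oo)%E /\
    forall i A, (mu i A <= nu A)%E.
Proof.
pose m k : {measure set (borel X) -> \bar R} :=
  if insub k is Some i then mu i else mzero.
have nuE A : msum m n A = (\sum_(i < n) mu i A)%E.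
  by apply: eq_bigr => i _; rewrite /m valK.
exists (msum m n); split.
  rewrite [ltLHS]nuE; apply: lte_sum_pinfty => i _.
  by rewrite probability_setT ltry.
move=> i A; rewrite [leRHS]nuE (bigD1 i) //=; apply: leeDl.
by apply: sume_ge0.
Qed.

(** If the inverses of [Q] and [T] differ at [x], then [Q] and [T] differ at the [T]-preimage of
    [x]. Adding the pushforwards of the [mu i] under the inverse of [T] therefore controls both
    halves of [Ediff]. *)
Lemma finite_period_dense : cantor_set R X ->
  closure_uniform R [set P : homeo X X | finite_period P] = setT.
Proof.
move=> cantorX; apply/seteqP; split=> // T _ B.
have hX := cantor_set_hausdorff cantorX.
have [_ cX mX _ _] := cantorX.
move=> /(nbhs_uniform _ _ hX)[n [mu [eps [eps0 subB]]]].
have eps2 : 0 < eps / 2 by rewrite divr_gt0.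
have [nu [nu_fin nu_ge]] :=
  finite_domination (cat_fam mu (fun i => distribution (mu i) (hinv_borel T))).
have [Q [D [perQ mD nuD QT]]] := finite_period_close nu_fin mX hX cX
  (cantor_set_zero_dimensional cantorX) (cantor_set_clopen_sub cantorX) T eps2.
exists Q; split => //; apply: subB => i.
have mSD : measurable (hinv_borel T @^-1` D).
  by rewrite -[X in measurable X]setTI; exact: measurable_hinv.
have ED : Ediff Q T `<=` D `|` hinv_borel T @^-1` D.
  move=> x [TQ|TQ]; first by left; apply: QT => QTx; exact: TQ.
  right; apply: QT => /= QTx; apply: TQ.
  by rewrite -[x in RHS](hinvK T) -QTx hfunK.
have mE : measurable (Ediff Q T : set (borel X)).
  by apply: open_borel; exact: open_Ediff.
apply: (@le_lt_trans _ _ (mu i (D `|` hinv_borel T @^-1` D))).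
  by apply: le_measure; rewrite ?inE //; exact: measurableU.
apply: (le_lt_trans (measureU2 _ mD mSD)); rewrite [eps]splitr EFinD.
apply: lteD.
  by apply: le_lt_trans nuD; have := nu_ge (lshift n i) D; rewrite cat_fam_lshift.
by apply: le_lt_trans nuD; have := nu_ge (rshift n i) D; rewrite cat_fam_rshift.
Qed.

End uniform_closure.

(** * Assembly of the three claims *)

Theorem theorem4p8 (R : realType) (Omega : ptopologicalType)
    (cantor_Omega : cantor_set R Omega) :
  let Homeo : set (homeo Omega Omega) := setT in
  let Per : set (homeo Omega Omega) := [set P | pointwise_periodic P] in
  let Per0 : set (homeo Omega Omega) := [set P | finite_period P] in
  [/\ closure_uniform R Per0 = Homeo,
      closure_weak Per `<` Homeo /\
        [set T | minimal_homeo T] `<=` closure_weak Per &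
      closure_weak Per = closure_weak Per0].
Proof.
move=> Homeo Per Per0.
have [_ cX _ _ _] := cantor_Omega.
have Per0_Per : Per0 `<=` Per by move=> P [n n0 Pn] x; exists n.
have cl_Per0_Per : closure_weak Per0 `<=` closure_weak Per :=
  @closureS (homeo_weak Omega) _ _ Per0_Per.
split; first exact: finite_period_dense.
- split; last first.
    by move=> T minT; apply: cl_Per0_Per; exact: minimal_closure_weak point cX minT.
  have [T [F [x [cF TF Fx nTFx]]]] := compressing_homeo_exists cantor_Omega.
  split=> // /(_ T I).
  exact: compressing_not_closure_weak cF TF Fx nTFx.
- apply/seteqP; split=> // T clT; apply/closure_weakP => k F cF.
  (* The same sets [F i] serve twice: [P] agrees with [T] on them, and [Q] with [P]. *)
  have [P perP WP] := (closure_weakP _ _).1 clT k F cF.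
  have clP := pointwise_periodic_closure_weak cX perP.
  have [Q perQ WQ] := (closure_weakP _ _).1 clP k F cF.
  by exists Q => // i; rewrite WQ WP.
Qed.
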